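(* Let $T=(t_{|i-j|})_{i,j=0}^{n-1}$ be an $n\times n$ symmetric positive definite Toeplitz matrix. The factorization algorithm FACTOR($T$), carried out in floating point arithmetic with relative precision $\epsilon$, produces an upper triangular matrix $\tilde U$ such that $$T=\tilde U^T\tilde U+\Delta T,$$ where $\|\Delta T\|=O(\epsilon t_0n^2)$ when mixed downdating is used, and $\|\Delta T\|=O(\epsilon t_0n^3)$ when hyperbolic downdating is used. Here the bounds are to first order in $\epsilon$: there is a constant $C$ independent of $n$ and $T$ such that, as $\epsilon\to0+$ with $T$ fixed, $\|\Delta T\|\le C\epsilon t_0n^2+O(\epsilon^2)$, respectively $\|\Delta T\|\le C\epsilon t_0n^3+O(\epsilon^2)$, where the constant in the $O(\epsilon^2)$ term may depend on $n$ and $T$.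
   Context: Notation: $\|\cdot\|$ is the Euclidean norm of vectors and the induced operator norm of matrices; $\mathbf e_k$ is the $k$th standard unit vector of $\mathbb R^n$; $Z=\sum_{i=1}^{n-1}\mathbf e_{i+1}\mathbf e_i^T$ is the shift-down matrix, $Z_0=I$, $Z_k=Z^k$ for $k>0$; $H(\theta)=\frac1{\cos\theta}\begin{pmatrix}1&-\sin\theta\\-\sin\theta&1\end{pmatrix}$. Algorithm FACTOR($T$) for the Toeplitz matrix $T$: put $\mathbf u_1=\mathbf u=(t_0,t_1,\dots,t_{n-1})^T/\sqrt{t_0}$ and $\mathbf v_1=\mathbf v=(0,t_1,\dots,t_{n-1})^T/\sqrt{t_0}$, so that $T-ZTZ^T=\mathbf u\mathbf u^T-\mathbf v\mathbf v^T$. For $k=1,\dots,n-1$ compute $\mathbf u_{k+1},\mathbf v_{k+1}$ with $\mathbf u_{k+1}\mathbf u_{k+1}^T-\mathbf v_{k+1}\mathbf v_{k+1}^T=Z\mathbf u_k\mathbf u_k^TZ^T-\mathbf v_k\mathbf v_k^T$ and $\mathbf e_{k+1}^T\mathbf v_{k+1}=0$ (an elementary downdating step), using $\sin\theta_k=\mathbf e_{k+1}^T\mathbf v_k/\mathbf e_k^T\mathbf u_k$, $\cos\theta_k=\sqrt{1-\sin^2\theta_k}$ as described below. In exact arithmetic the steps are well defined, $\mathbf e_j^T\mathbf u_k=0$ for $j<k$, $\mathbf e_j^T\mathbf v_k=0$ for $j\le k$, and $T=U^TU$ with $U=\sum_{k=1}^n\mathbf e_k\mathbf u_k^T$. Hyperbolic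 downdating evaluates $\mathbf u_{k+1}=(Z\mathbf u_k-\sin\theta_k\mathbf v_k)/\cos\theta_k$ and $\mathbf v_{k+1}=(\mathbf v_k-\sin\theta_kZ\mathbf u_k)/\cos\theta_k$. Mixed downdating evaluates either $\mathbf v_{k+1}=(\mathbf v_k-\sin\theta_kZ\mathbf u_k)/\cos\theta_k$ and then $\mathbf u_{k+1}=-\sin\theta_k\mathbf v_{k+1}+\cos\theta_kZ\mathbf u_k$, or $\mathbf u_{k+1}=(Z\mathbf u_k-\sin\theta_k\mathbf v_k)/\cos\theta_k$ and then $\mathbf v_{k+1}=-\sin\theta_k\mathbf u_{k+1}+\cos\theta_k\mathbf v_k$. Floating point setting: $\tilde{\mathbf u}_k,\tilde{\mathbf v}_k$ denote the values of $\mathbf u_k,\mathbf v_k$ computed in floating point arithmetic with relative precision $\epsilon$ (with the same zero patterns as the exact vectors), and $\tilde U=\sum_{k=1}^n\mathbf e_k\tilde{\mathbf u}_k^T$. As $\epsilon\to0+$ with the problem fixed, $\tilde{\mathbf u}_k=\mathbf u_k+O(\epsilon)$, $\tilde{\mathbf v}_k=\mathbf v_k+O(\epsilon)$; the initial vectors are obtained by rounding componentwise, so $\|\tilde{\mathbf u}_1-\mathbf u\|$ and $\|\tilde{\mathbf v}_1-\mathbf v\|$ are at most $c_0\epsilon\|\mathbf u\|+O(\epsilon^2)$ with $c_0$ an absolute constant. The following standing facts on the rounding errors of one downdating step are taken as given: for $k=1,\dots,n-1$, $$\tilde{\mathbf u}_{k+1}\tilde{\mathbf u}_{k+1}^T-\tilde{\mathbf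 v}_{k+1}\tilde{\mathbf v}_{k+1}^T=Z\tilde{\mathbf u}_k\tilde{\mathbf u}_k^TZ^T-\tilde{\mathbf v}_k\tilde{\mathbf v}_k^T+\epsilon G_k+O(\epsilon^2),$$ where for all $j=0,\dots,n-1$, with positive constants $c_m,c_h$ of order unity independent of $n$ and $T$, $$\|Z_jG_kZ_j^T\|\le c_m\left(\|Z_{j+1}\mathbf u_k\|^2+\|Z_j\mathbf v_k\|^2+\|Z_j\mathbf u_{k+1}\|^2+\|Z_j\mathbf v_{k+1}\|^2\right)$$ when mixed downdating is used, and $$\|Z_jG_kZ_j^T\|\le c_h\|H(\theta_k)\|\left(\|Z_{j+1}\mathbf u_k\|+\|Z_j\mathbf v_k\|\right)\left(\|Z_j\mathbf u_{k+1}\|+\|Z_j\mathbf v_{k+1}\|\right)$$ when hyperbolic downdating is used. Here the $O(\epsilon^2)$ term is a matrix whose elements are bounded by a constant multiple of $\epsilon^2\|G_k\|$. *)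

(* Defs.v *)
From HB Require Import structures.
From mathcomp Require Import all_boot all_order all_algebra.
From mathcomp Require Import all_classical all_reals all_analysis.

Set Implicit Arguments.
Unset Strict Implicit.
Unset Printing Implicit Defensive.

Import Order.TTheory GRing.Theory Num.Theory.
Import numFieldNormedType.Exports.

Local Open Scope classical_set_scope.
Local Open Scope ring_scope.

Section Norms.
Variable R : realType.

Definition enorm n (x : 'cV[R]_n) : R := Num.sqrt (\sum_i x i 0 ^+ 2).

(* The operator norm induced by [enorm]; the norm `|A| that the library puts
   on matrices is the largest absolute value of an entry. *)
Definition opnorm m n (A : 'M[R]_(m, n)) : R :=
  sup [set enorm (A *m x) | x in [set x | enorm x <= 1]].

(* f(eps) <= a * eps + O(eps^2) as eps -> 0+ *)
Definition le_first_order (f : R -> R) (a : R) : Prop :=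
  exists K : R, \forall eps \near (0 : R)^'+,
    f eps <= a * eps + K * eps ^+ 2.

End Norms.

Section Factor.
Variables (R : realType) (n : nat).

Definition posdef (A : 'M[R]_n) : Prop :=
  A^T = A /\ forall x : 'cV[R]_n, x != 0 -> 0 < (x^T *m A *m x) 0 0.

(* Only t 0, ..., t n.-1 matter. *)
Definition toeplitz (t : nat -> R) : 'M[R]_n :=
  \matrix_(i, j) t `|i%:Z - j%:Z|%N.

(* Indices of vectors and of steps start from 0: [evec k] is the unit vector
   e_(k+1) of the 1-based convention, and it is 0 when n <= k. *)
Definition evec (k : nat) : 'cV[R]_n := \col_i ((i : nat) == k)%:R.

Definition shift : 'M[R]_n := \matrix_(i, j) ((i : nat) == j.+1)%:R.

Definition rows_of (u : nat -> 'cV[R]_n) : 'M[R]_n :=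
  \sum_(k < n) evec k *m (u k)^T.

(* H(theta), as a function of s = sin theta and c = cos theta. *)
Definition Hmx (s c : R) : 'M[R]_2 :=
  c^-1 *: \matrix_(i, j) (if i == j then 1 else - s).

(* The three ways of evaluating one downdating step; the last two are the two
   variants of mixed downdating, named after the vector obtained first. *)
Inductive rule := Hyperbolic | MixedV | MixedU.

Definition is_mixed (r : rule) : bool :=
  if r is Hyperbolic then false else true.

Definition downdate (r : rule) (s c : R) (Zu v : 'cV[R]_n) :
    'cV[R]_n * 'cV[R]_n :=
  match r with
  | Hyperbolic => (c^-1 *: (Zu - s *: v), c^-1 *: (v - s *: Zu))
  | MixedV => let v' := c^-1 *: (v - s *: Zu) in (c *: Zu - s *: v', v')
  | MixedU => let u' := c^-1 *: (Zu - s *: v) in (u', c *: v - s *: u')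
  end.

Section ExactRun.
Variables (t : nat -> R) (r : nat -> rule).

Definition u_init : 'cV[R]_n := \col_(i < n) (t i / Num.sqrt (t 0%N)).
Definition v_init : 'cV[R]_n :=
  \col_(i < n) (if (i : nat) == 0%N then 0 else t i / Num.sqrt (t 0%N)).

Definition sin_of (k : nat) (uv : 'cV[R]_n * 'cV[R]_n) : R :=
  ((evec k.+1)^T *m uv.2) 0 0 / ((evec k)^T *m uv.1) 0 0.

Definition cos_of (k : nat) (uv : 'cV[R]_n * 'cV[R]_n) : R :=
  Num.sqrt (1 - sin_of k uv ^+ 2).

(* Exact arithmetic; step k is evaluated by the rule r k. *)
Fixpoint factor (k : nat) : 'cV[R]_n * 'cV[R]_n :=
  if k is k'.+1 then
    let uv := factor k' in
    downdate (r k') (sin_of k' uv) (cos_of k' uv) (shift *m uv.1) uv.2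
  else (u_init, v_init).

Definition u_ (k : nat) : 'cV[R]_n := (factor k).1.
Definition v_ (k : nat) : 'cV[R]_n := (factor k).2.
Definition sin_ (k : nat) : R := sin_of k (factor k).
Definition cos_ (k : nat) : R := cos_of k (factor k).

(* Bound on || Z_j G_k Z_j^T || for the local error of step k. *)
Definition local_bound (cm ch : R) (k j : nat) : R :=
  if is_mixed (r k) then
    cm * (enorm (shift ^+ j.+1 *m u_ k) ^+ 2 +
          enorm (shift ^+ j *m v_ k) ^+ 2 +
          enorm (shift ^+ j *m u_ k.+1) ^+ 2 +
          enorm (shift ^+ j *m v_ k.+1) ^+ 2)
  else
    ch * opnorm (Hmx (sin_ k) (cos_ k)) *
    (enorm (shift ^+ j.+1 *m u_ k) + enorm (shift ^+ j *m v_ k)) *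
    (enorm (shift ^+ j *m u_ k.+1) + enorm (shift ^+ j *m v_ k.+1)).

(* ut eps k and vt eps k are the vectors computed in place of u_ k and v_ k
   with relative precision eps.  All facts about them are asymptotic, for
   eps -> 0+ with n, t and r fixed. *)
Record computed (c0 cm ch : R) (ut vt : R -> nat -> 'cV[R]_n) : Prop :=
  Computed {
  computed_zeros : \forall eps \near (0 : R)^'+,
    forall (k : nat) (i : 'I_n), (k < n)%N ->
      ((i < k)%N -> ut eps k i 0 = 0) /\ ((i <= k)%N -> vt eps k i 0 = 0);
  computed_approx : exists K : R, \forall eps \near (0 : R)^'+,
    forall k : nat, (k < n)%N ->
      enorm (ut eps k - u_ k) <= K * eps /\ enorm (vt eps k - v_ k) <= K * eps;
  computed_init :
    le_first_order (fun eps => enorm (ut eps 0%N - u_init))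
      (c0 * enorm u_init) /\
    le_first_order (fun eps => enorm (vt eps 0%N - v_init))
      (c0 * enorm u_init);
  computed_step : exists (G E : R -> nat -> 'M[R]_n) (K : R),
    \forall eps \near (0 : R)^'+, forall k : nat, (k.+1 < n)%N ->
      [/\ ut eps k.+1 *m (ut eps k.+1)^T - vt eps k.+1 *m (vt eps k.+1)^T =
            shift *m ut eps k *m (ut eps k)^T *m shift^T
            - vt eps k *m (vt eps k)^T + eps *: G eps k + E eps k,
          forall i j, `|E eps k i j| <= K * (eps ^+ 2 * opnorm (G eps k)) &
          forall j : nat, (j < n)%N ->
            opnorm (shift ^+ j *m G eps k *m (shift ^+ j)^T)
              <= local_bound cm ch k j] }.

End ExactRun.
End Factor.

(* Main.v *)
(** Both T and Ut^T Ut = sum_k ut_k ut_k^T are recovered from their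
displacements through D = sum_j Z^j (D - Z D Z^T) (Z^j)^T.  The rounded steps
telescope, so the displacement of the error T - Ut^T Ut consists of the initial
rounding errors and the sum of the local errors eps G_k, and to first order the
error is bounded by the sum over j and k of the bounds on |Z^j G_k (Z^j)^T|.

The trace of Z^j (exact step) (Z^j)^T gives |Z^j v_k| <= |Z^(j+1) u_k| by
backward induction on k, and the trace of T = U^T U gives
sum_k |u_k|^2 = n t_0; this settles mixed downdating.  For hyperbolic
downdating |H| <= 2 / c has to be absorbed: from
c Z u_k = u_(k+1) + s v_(k+1) and |Z^j v_(k+1)| <= |Z^(j+1) u_(k+1)| one gets
|Z^j u_(k+1)| <= c |Z^(j+1) u_k| + |Z^(j+1) u_(k+1)|, hence
|Z^j u_(k+1)| <= n c |Z^(j+1) u_k|, at the price of one more factor n. *)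
Require Import Defs.
From HB Require Import structures.
From mathcomp Require Import all_boot all_order all_algebra.
From mathcomp Require Import all_classical all_reals all_analysis.
From mathcomp Require Import ring lra zify.

Set Implicit Arguments.
Unset Strict Implicit.
Unset Printing Implicit Defensive.

Import Order.TTheory GRing.Theory Num.Theory.
Import numFieldNormedType.Exports.

Local Open Scope classical_set_scope.
Local Open Scope ring_scope.

(** * The Euclidean norm and the Cauchy-Schwarz inequality *)

Section EuclideanNorm.
Variable R : realType.

(** Lagrange's identity: twice the difference of the two sides is the double sum of the squares of
    [a i * b j - a j * b i]. *)
Lemma cauchy_schwarz_sum (I : finType) (a b : I -> R) :
  (\sum_i a i * b i) ^+ 2 <= (\sum_i a i ^+ 2) * (\sum_i b i ^+ 2).
Proof.
have dbl : (\sum_i a i ^+ 2) * (\sum_i b i ^+ 2) *+ 2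
    - (\sum_i a i * b i) ^+ 2 *+ 2
    = \sum_i \sum_j (a i * b j - a j * b i) ^+ 2.
  rewrite !mulr2n {2}[_ * (\sum_i b i ^+ 2)]mulrC expr2 !big_distrlr /=.
  rewrite -!big_split -sumrB /=; apply: eq_bigr => i _.
  by rewrite -!big_split -sumrB /=; apply: eq_bigr => j _; ring.
rewrite -(@ler_pMn2r _ 2) // -subr_ge0 dbl.
by apply: sumr_ge0 => i _; apply: sumr_ge0 => j _; exact: sqr_ge0.
Qed.

Section Fixed.
Variable n : nat.
Implicit Types x y : 'cV[R]_n.

Lemma enorm_ge0 x : 0 <= enorm x.
Proof. exact: sqrtr_ge0. Qed.

Lemma enorm_sqr x : enorm x ^+ 2 = \sum_i x i 0 ^+ 2.
Proof. by rewrite sqr_sqrtr // sumr_ge0 // => i _; exact: sqr_ge0. Qed.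

Lemma enorm0 : enorm (0 : 'cV[R]_n) = 0.
Proof.
by rewrite /enorm big1 ?sqrtr0 // => i _; rewrite mxE expr0n.
Qed.

Lemma enormZ (a : R) x : enorm (a *: x) = `|a| * enorm x.
Proof.
rewrite /enorm -sqrtr_sqr -sqrtrM ?sqr_ge0 // mulr_sumr.
by congr Num.sqrt; apply: eq_bigr => i _; rewrite mxE exprMn.
Qed.

Lemma dot_le_enorm x y : \sum_i x i 0 * y i 0 <= enorm x * enorm y.
Proof.
apply: le_trans (ler_norm _) _.
rewrite -(@ler_pXn2r _ 2) ?nnegrE ?mulr_ge0 ?enorm_ge0 // exprMn !enorm_sqr.
by rewrite real_normK ?num_real // cauchy_schwarz_sum.
Qed.

Lemma enormD x y : enorm (x + y) <= enorm x + enorm y.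
Proof.
rewrite -(@ler_pXn2r _ 2) ?nnegrE ?addr_ge0 ?enorm_ge0 // sqrrD !enorm_sqr.
have cs := dot_le_enorm x y.
have -> : \sum_i (x + y) i 0 ^+ 2 = \sum_i x i 0 ^+ 2
    + (\sum_i x i 0 * y i 0) *+ 2 + \sum_i y i 0 ^+ 2.
  rewrite mulr2n -!big_split /=; apply: eq_bigr => i _.
  by rewrite mxE; ring.
by rewrite lerD2r lerD2l ler_pMn2r.
Qed.

Lemma le_entry_enorm x i : `|x i 0| <= enorm x.
Proof.
rewrite -(@ler_pXn2r _ 2) ?nnegrE ?enorm_ge0 // enorm_sqr.
rewrite real_normK ?num_real // (bigD1 i) //= lerDl.
by apply: sumr_ge0 => k _; exact: sqr_ge0.
Qed.

Lemma enorm_eq0 x : enorm x <= 0 -> x = 0.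
Proof.
move=> x0; apply/matrixP => i j; rewrite ord1 mxE.
apply/eqP; rewrite -normr_le0; exact: le_trans (le_entry_enorm x i) x0.
Qed.

End Fixed.

(** Cauchy-Schwarz applied to each row. This Frobenius bound is what makes the set in the definition
    of [opnorm] bounded above. *)
Lemma enorm_mulmx_le m n (A : 'M[R]_(m, n)) (x : 'cV[R]_n) :
  enorm (A *m x) <= Num.sqrt (\sum_i \sum_j A i j ^+ 2) * enorm x.
Proof.
have S0 : 0 <= \sum_i \sum_j A i j ^+ 2.
  by apply: sumr_ge0 => i _; apply: sumr_ge0 => j _; exact: sqr_ge0.
rewrite -(@ler_pXn2r _ 2) ?nnegrE ?mulr_ge0 ?sqrtr_ge0 ?enorm_ge0 //.
rewrite exprMn !enorm_sqr sqr_sqrtr // mulr_suml; apply: ler_sum => i _.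
by rewrite mxE cauchy_schwarz_sum.
Qed.

End EuclideanNorm.

(** * The operator norm induced by the Euclidean norm *)

Section OperatorNorm.
Variable R : realType.
Local Open Scope classical_set_scope.

Lemma opnorm_le m n (A : 'M[R]_(m, n)) (B : R) : 0 <= B ->
  (forall x : 'cV[R]_n, enorm (A *m x) <= B * enorm x) -> opnorm A <= B.
Proof.
move=> B0 AB; apply: ge_sup.
  by exists (enorm (A *m 0)), 0 => //=; rewrite enorm0.
move=> _ [x /= x1 <-]; apply: le_trans (AB x) _.
by rewrite -[leRHS]mulr1 ler_wpM2l.
Qed.

(** For nonzero [x], rescaling to length 1 makes [enorm (A *m x) / enorm x] an element of the set
    whose supremum is taken. *)
Lemma enorm_mulmx m n (A : 'M[R]_(m, n)) (x : 'cV[R]_n) :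
  enorm (A *m x) <= opnorm A * enorm x.
Proof.
have [x0|x0] := leP (enorm x) 0.
  by rewrite (enorm_eq0 x0) mulmx0 !enorm0 mulr0.
rewrite -ler_pdivrMr // mulrC -[(enorm x)^-1]gtr0_norm ?invr_gt0 //.
rewrite -enormZ scalemxAr; apply: ub_le_sup.
  exists (Num.sqrt (\sum_i \sum_j A i j ^+ 2)) => _ [y /= y1 <-].
  apply: le_trans (enorm_mulmx_le A y) _.
  by rewrite -[leRHS]mulr1 ler_wpM2l // sqrtr_ge0.
exists ((enorm x)^-1 *: x) => //=.
by rewrite enormZ gtr0_norm ?invr_gt0 // mulVf // gt_eqF.
Qed.

Lemma opnorm_ge0 m n (A : 'M[R]_(m, n)) : 0 <= opnorm A.
Proof.
apply: le_trans (enorm_ge0 (A *m 0)) _; apply: ub_le_sup.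
  exists (Num.sqrt (\sum_i \sum_j A i j ^+ 2)) => _ [y /= y1 <-].
  apply: le_trans (enorm_mulmx_le A y) _.
  by rewrite -[leRHS]mulr1 ler_wpM2l // sqrtr_ge0.
by exists 0 => //=; rewrite enorm0.
Qed.

Lemma opnorm_le_frobenius m n (A : 'M[R]_(m, n)) :
  opnorm A <= Num.sqrt (\sum_i \sum_j A i j ^+ 2).
Proof. by apply: opnorm_le (sqrtr_ge0 _) _ => x; exact: enorm_mulmx_le. Qed.

(** Converts the entrywise control of the second-order remainder into a norm bound; the factor [n]
    only enters the [eps ^+ 2] term. *)
Lemma opnorm_le_entries n (A : 'M[R]_n) (B : R) : 0 <= B ->
  (forall i j, `|A i j| <= B) -> opnorm A <= n%:R * B.
Proof.
move=> B0 AB; apply: le_trans (opnorm_le_frobenius A) _.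
rewrite -[leRHS]ger0_norm ?mulr_ge0 // -sqrtr_sqr ler_wsqrtr //.
have -> : (n%:R * B) ^+ 2 = \sum_(i < n) \sum_(j < n) B ^+ 2.
  by rewrite !sumr_const card_ord -mulrnA -[RHS]mulr_natl natrM; ring.
apply: ler_sum => i _; apply: ler_sum => j _.
by rewrite -real_normK ?num_real // ler_pXn2r ?nnegrE.
Qed.

Lemma opnorm0 m n : opnorm (0 : 'M[R]_(m, n)) = 0.
Proof.
apply/eqP; rewrite eq_le opnorm_ge0 andbT.
by apply: opnorm_le => // x; rewrite mul0mx enorm0 mul0r.
Qed.

Lemma opnorm_eq0 m n (A : 'M[R]_(m, n)) : opnorm A <= 0 -> A = 0.
Proof.
move=> A0; apply/matrixP => i j; rewrite mxE.
have /matrixP/(_ i 0) : A *m delta_mx j 0 = 0 :> 'cV[R]_m.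
  apply: enorm_eq0; apply: le_trans (enorm_mulmx _ _) _.
  by rewrite mulr_le0_ge0 // enorm_ge0.
by rewrite -colE !mxE.
Qed.

Lemma opnormD m n (A B : 'M[R]_(m, n)) : opnorm (A + B) <= opnorm A + opnorm B.
Proof.
apply: opnorm_le => [|x]; first by rewrite addr_ge0 // opnorm_ge0.
rewrite mulmxDl mulrDl; apply: le_trans (enormD _ _) _.
by apply: lerD; exact: enorm_mulmx.
Qed.

Lemma opnormZ_le m n (a : R) (A : 'M[R]_(m, n)) :
  opnorm (a *: A) <= `|a| * opnorm A.
Proof.
apply: opnorm_le => [|x]; first by rewrite mulr_ge0 // opnorm_ge0.
by rewrite -scalemxAl enormZ -mulrA ler_wpM2l // enorm_mulmx.
Qed.

Lemma opnormN m n (A : 'M[R]_(m, n)) : opnorm (- A) = opnorm A.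
Proof.
have le (B : 'M[R]_(m, n)) : opnorm (- B) <= opnorm B.
  rewrite -scaleN1r; apply: le_trans (opnormZ_le _ _) _.
  by rewrite normrN1 mul1r.
by apply/eqP; rewrite eq_le le /= -{1}[A]opprK le.
Qed.

Lemma opnormB m n (A B : 'M[R]_(m, n)) : opnorm (A - B) <= opnorm A + opnorm B.
Proof. by rewrite -(opnormN B) opnormD. Qed.

Lemma opnorm_sum m n (I : finType) (P : pred I) (A : I -> 'M[R]_(m, n)) :
  opnorm (\sum_(i | P i) A i) <= \sum_(i | P i) opnorm (A i).
Proof.
elim/big_rec2: _ => [|i y B _ yB]; first by rewrite opnorm0.
by apply: le_trans (opnormD _ _) _; rewrite lerD2l.
Qed.

Lemma opnormM m n p (A : 'M[R]_(m, n)) (B : 'M[R]_(n, p)) :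
  opnorm (A *m B) <= opnorm A * opnorm B.
Proof.
apply: opnorm_le => [|x]; first by rewrite mulr_ge0 // opnorm_ge0.
rewrite -mulmxA -mulrA; apply: le_trans (enorm_mulmx _ _) _.
by rewrite ler_wpM2l ?opnorm_ge0 // enorm_mulmx.
Qed.

(** With [y = A^T x], the square of |y| is the inner product of [A y] and [x], hence at most |A| |y|
    |x|; then |y| is cancelled. *)
Lemma opnorm_trmx_le m n (A : 'M[R]_(m, n)) : opnorm A^T <= opnorm A.
Proof.
apply: opnorm_le (opnorm_ge0 A) _ => x; set y := A^T *m x.
have [y0|y0] := leP (enorm y) 0.
  by apply: le_trans y0 _; rewrite mulr_ge0 ?opnorm_ge0 ?enorm_ge0.
rewrite -(ler_pM2l y0) -expr2 enorm_sqr.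
have -> : \sum_i y i 0 ^+ 2 = \sum_i (A *m y) i 0 * x i 0.
  have -> : \sum_i (A *m y) i 0 * x i 0 = ((A *m y)^T *m x) 0 0.
    by rewrite mxE; apply: eq_bigr => i _; rewrite [in RHS]mxE.
  rewrite trmx_mul -mulmxA mxE.
  by apply: eq_bigr => i _; rewrite [in RHS]mxE expr2.
apply: le_trans (dot_le_enorm _ _) _.
by rewrite mulrCA mulrA ler_wpM2r ?enorm_ge0 // enorm_mulmx.
Qed.

Lemma opnorm_outer_le m n (x : 'cV[R]_m) (y : 'cV[R]_n) :
  opnorm (x *m y^T) <= enorm x * enorm y.
Proof.
apply: le_trans (opnorm_le_frobenius _) _.
rewrite /enorm -sqrtrM ?sumr_ge0 // => [|i _]; last exact: sqr_ge0.
rewrite big_distrlr /= ler_wsqrtr //.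
apply: ler_sum => i _; apply: ler_sum => j _.
by rewrite mxE big_ord1 mxE exprMn.
Qed.

Lemma opnorm_outer_diff n (a u : 'cV[R]_n) :
  opnorm (a *m a^T - u *m u^T)
    <= 2 * enorm u * enorm (a - u) + enorm (a - u) ^+ 2.
Proof.
set d := a - u.
have -> : a *m a^T - u *m u^T = u *m d^T + d *m u^T + d *m d^T.
  have -> : a = u + d by rewrite /d addrCA subrr addr0.
  by rewrite linearD /= mulmxDl !mulmxDr addrC !addrA addNr add0r.
apply: le_trans (opnormD _ _) _.
have -> : 2 * enorm u * enorm d + enorm d ^+ 2
    = enorm u * enorm d + enorm d * enorm u + enorm d * enorm d by ring.
apply: lerD; last exact: opnorm_outer_le.
by apply: le_trans (opnormD _ _) _; apply: lerD; exact: opnorm_outer_le.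
Qed.

End OperatorNorm.

(** * Entries of shifted matrices *)

Section ShiftEntries.
Variables (R : realType) (n : nat).
Local Notation Z := (Defs.shift R n).

Lemma ord_zero_or_succ (i : 'I_n) :
  (i : nat) = 0%N \/ exists k : 'I_n, (i : nat) = k.+1.
Proof.
case: i => -[|i] lt_in; [by left | right].
by exists (Ordinal (ltnW lt_in)).
Qed.

Section Entries.
Variables (p : nat) (A : 'M[R]_(n, p)).

Lemma shift_mulmx_top (i : 'I_n) j : (i : nat) = 0%N -> (Z *m A) i j = 0.
Proof.
by move=> i0; rewrite mxE big1 // => k _; rewrite mxE i0 mul0r.
Qed.

Lemma shift_mulmx_succ (i k : 'I_n) j :
  (i : nat) = k.+1 -> (Z *m A) i j = A k j.
Proof.
move=> ik; rewrite mxE (bigD1 k) //= mxE ik eqxx mul1r big1 ?addr0 // => l lk.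
by rewrite mxE ik eqSS eq_sym (negbTE (_ : l != k :> nat)) ?mul0r.
Qed.

Lemma shift_exprS j : Z ^+ j.+1 *m A = Z *m (Z ^+ j *m A).
Proof. by rewrite exprS -mulmxA. Qed.

Lemma shift_exprSr j : Z ^+ j.+1 *m A = Z ^+ j *m (Z *m A).
Proof. by rewrite exprSr -mulmxA. Qed.

End Entries.

End ShiftEntries.

(** * The shift as a nilpotent contraction, and displacements *)

Section Shift.
Variables (R : realType) (n : nat).
Local Notation Z := (Defs.shift R n).

(** Each shift clears one more row from the top: the first [m] rows of [Z ^+ m *m A] vanish. *)
Lemma shift_expr_nilpotent p (A : 'M[R]_(n, p)) : Z ^+ n *m A = 0.
Proof.
suff top0 m (i : 'I_n) j : (i < m)%N -> (Z ^+ m *m A) i j = 0.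
  by apply/matrixP => i j; rewrite top0 ?mxE.
elim: m i => // m IH i; rewrite shift_exprS => lt_im.
have [i0|[k ik]] := ord_zero_or_succ i; first exact: shift_mulmx_top.
by rewrite (shift_mulmx_succ _ _ ik) IH // -ltnS -ik.
Qed.

Lemma enorm_shift (x : 'cV[R]_n) : enorm (Z *m x) <= enorm x.
Proof.
rewrite /enorm ler_wsqrtr //; case: n x => [|m] x; first by rewrite !big_ord0.
rewrite big_ord_recl shift_mulmx_top // expr0n add0r big_ord_recr /=.
apply: ler_wpDr; first exact: sqr_ge0.
apply: ler_sum => i _.
by rewrite (@shift_mulmx_succ _ _ _ x _ (widen_ord (leqnSn m) i)).
Qed.

Lemma enorm_shift_expr j (x : 'cV[R]_n) : enorm (Z ^+ j *m x) <= enorm x.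
Proof.
elim: j => [|j IH]; first by rewrite mul1mx.
by rewrite shift_exprS; apply: le_trans (enorm_shift _) IH.
Qed.

Lemma enorm_shift_exprS j (x : 'cV[R]_n) :
  enorm (Z ^+ j.+1 *m x) <= enorm (Z ^+ j *m x).
Proof. by rewrite shift_exprS enorm_shift. Qed.

Lemma opnorm_shift_congr j (A : 'M[R]_n) :
  opnorm (Z ^+ j *m A *m (Z ^+ j)^T) <= opnorm A.
Proof.
have Z1 : opnorm (Z ^+ j) <= 1.
  by apply: opnorm_le => // x; rewrite mul1r enorm_shift_expr.
have Zt1 : opnorm (Z ^+ j)^T <= 1.
  exact: le_trans (opnorm_trmx_le _) Z1.
apply: le_trans (opnormM _ _) _; rewrite -[leRHS]mulr1.
apply: ler_pM; rewrite ?opnorm_ge0 //.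
apply: le_trans (opnormM _ _) _; rewrite -[leRHS]mul1r.
by rewrite ler_wpM2r // opnorm_ge0.
Qed.

Lemma outerE (x : 'cV[R]_n) i j : (x *m x^T) i j = x i 0 * x j 0.
Proof. by rewrite mxE big_ord1 [X in _ * X]mxE. Qed.

(** The sum telescopes to D minus its congruence by [Z ^+ n], which vanishes by nilpotency. A matrix
    is thus determined by its displacement. *)
Lemma displacement_expansion (D : 'M[R]_n) :
  D = \sum_(j < n) Z ^+ j *m (D - Z *m D *m Z^T) *m (Z ^+ j)^T.
Proof.
suff partial m : \sum_(j < m) Z ^+ j *m (D - Z *m D *m Z^T) *m (Z ^+ j)^T
    = D - Z ^+ m *m D *m (Z ^+ m)^T.
  by rewrite partial shift_expr_nilpotent mul0mx subr0.
elim: m => [|m IH].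
  by rewrite big_ord0 mul1mx trmx1 mulmx1 subrr.
rewrite big_ord_recr /= {}IH mulmxBr mulmxBl.
have -> : Z ^+ m *m (Z *m D *m Z^T) *m (Z ^+ m)^T
    = Z ^+ m.+1 *m D *m (Z ^+ m.+1)^T.
  by rewrite exprSr trmx_mul !mulmxA.
by rewrite addrA subrK.
Qed.

(** Entries depend only on [i - j], so shifting along the diagonal changes nothing outside the first
    row and column. The vectors [u_init] and [v_init] differ only in entry 0, so their outer
    products also cancel there. *)
Lemma toeplitz_displacement (t : nat -> R) : 0 < t 0%N ->
  toeplitz n t - Z *m toeplitz n t *m Z^T
    = u_init n t *m (u_init n t)^T - v_init n t *m (v_init n t)^T.
Proof.
move=> t0; have s2 : t 0%N = Num.sqrt (t 0%N) * Num.sqrt (t 0%N).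
  by rewrite -expr2 sqr_sqrtr // ltW.
have cancel x : t 0%N / Num.sqrt (t 0%N) * (x / Num.sqrt (t 0%N)) = x.
  by rewrite mulrACA -invfM -s2 mulrAC divff ?mul1r // gt_eqF.
(* Right multiplication by [Z^T] becomes left multiplication by [Z] of a transpose, so the row
   lemmas also serve for columns. *)
have congrE : Z *m toeplitz n t *m Z^T = (Z *m (Z *m toeplitz n t)^T)^T.
  by rewrite trmx_mul trmxK.
have shiftedE i j : (Z *m toeplitz n t *m Z^T) i j =
    if ((i : nat) == 0%N) || ((j : nat) == 0%N) then 0 else toeplitz n t i j.
  rewrite congrE mxE; have [j0|[j' jS]] := ord_zero_or_succ j.
    by rewrite shift_mulmx_top // j0 orbT.
  rewrite (shift_mulmx_succ _ _ jS) mxE jS orbF.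
  have [i0|[i' iS]] := ord_zero_or_succ i.
    by rewrite shift_mulmx_top // i0.
  rewrite (shift_mulmx_succ _ _ iS) iS !mxE iS jS; congr (t `|_|%N).
  by rewrite -[i'.+1]addn1 -[j'.+1]addn1 !PoszD opprD addrACA subrr addr0.
apply/matrixP => i j.
rewrite [LHS]mxE [X in _ + X]mxE shiftedE [RHS]mxE [X in _ = _ + X]mxE !outerE.
rewrite !mxE; have [i0|[i' iS]] := ord_zero_or_succ i;
  have [j0|[j' jS]] := ord_zero_or_succ j; rewrite ?i0 ?j0 ?iS ?jS /=.
- by rewrite mul0r !subr0 addn0 cancel.
- by rewrite mul0r !subr0 subn0 cancel.
- by rewrite mulr0 !subr0 addn0 mulrC cancel.
- by rewrite !subrr.
Qed.

End Shift.

(** * Telescoping of perturbed downdating steps *)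

Section DisplacementSum.
Variables (R : realType) (n : nat).
Local Notation Z := (Defs.shift R n).
Variables (a b : nat -> 'cV[R]_n) (F : nat -> 'M[R]_n).
Hypothesis step : forall k, (k.+1 < n)%N ->
  a k.+1 *m (a k.+1)^T - b k.+1 *m (b k.+1)^T
    = Z *m a k *m (a k)^T *m Z^T - b k *m (b k)^T + F k.

(** The hypothesis [step] pairs the outer product of [a k.+1] with the shifted one of [a k]. The [b]
    terms then telescope, leaving their two ends and the last shifted term. *)
Lemma partial_displacement m : (m < n)%N ->
  \sum_(k < m.+1) a k *m (a k)^T
    - Z *m (\sum_(k < m.+1) a k *m (a k)^T) *m Z^T
  = a 0%N *m (a 0%N)^T - b 0%N *m (b 0%N)^T + \sum_(k < m) F k
    + b m *m (b m)^T - Z *m (a m *m (a m)^T) *m Z^T.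
Proof.
elim: m => [|m IH] lt_mn.
  by rewrite big_ord1 big_ord0 addr0 subrK.
rewrite big_ord_recr /= mulmxDr mulmxDl [in RHS]big_ord_recr /=.
have := step lt_mn; rewrite -(mulmxA Z); move: (IH (ltnW lt_mn)).
(* The matrix products are generalized to atoms, so that the claim becomes a linear identity in each
   entry. *)
move: (Z *m (\sum_(k < m.+1) _) *m _) (Z *m (a m *m _) *m _) => ZS ZP.
move: (Z *m (a m.+1 *m _) *m _) (\sum_(k < m.+1) _) (\sum_(k < m) _) => ZQ S T.
move: (a m.+1 *m _) (b m.+1 *m _) (a 0%N *m _) (b 0%N *m _) => Q B1 A0 B0.
move: (b m *m _) (F m) => B f.
move=> /matrixP h1 /matrixP h2; apply/matrixP => i j.
move: (h1 i j) (h2 i j); rewrite !mxE; lra.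
Qed.

(** At the last index both boundary terms vanish: [b n.-1] is 0, and the only possibly nonzero entry
    of [a n.-1] is its last, which [Z] shifts out. It is used with [F = 0] for the exact vectors and
    with the local errors for the computed ones. *)
Lemma rank_one_sum_expansion : (0 < n)%N ->
  (forall i : 'I_n, (i < n.-1)%N -> a n.-1 i 0 = 0) -> b n.-1 = 0 ->
  \sum_(k < n) a k *m (a k)^T
  = \sum_(j < n) Z ^+ j *m
      (a 0%N *m (a 0%N)^T - b 0%N *m (b 0%N)^T + \sum_(k < n.-1) F k)
      *m (Z ^+ j)^T.
Proof.
move=> n0 a_last b_last; rewrite [LHS]displacement_expansion.
have Za : Z *m a n.-1 = 0.
  apply/matrixP => i j; rewrite ord1 [RHS]mxE.
  have [i0|[k ik]] := ord_zero_or_succ i; first exact: shift_mulmx_top.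
  rewrite (shift_mulmx_succ _ _ ik) a_last // -ltnS -ik prednK //.
have := @partial_displacement n.-1; rewrite prednK // => -> //.
by rewrite mulmxA Za !mul0mx subr0 b_last mul0mx addr0.
Qed.

End DisplacementSum.

(** * Limits and bounds to first order in [eps] *)

Section FirstOrder.
Variable R : realType.
Implicit Types (f g : R -> R) (a b : R).

(** Passage to the limit: this is how identities between exact quantities, free of [eps], are
    extracted from computed ones. *)
Lemma near_le_linear (x K : R) :
  (\forall eps \near (0 : R)^'+, x <= K * eps) -> x <= 0.
Proof.
move=> xK; rewrite leNgt; apply/negP => x0.
(* Adding 1 keeps the denominator positive when [K = 0]. *)
have d0 : 0 < `|K| + 1 by rewrite ltr_wpDl.
near (0 : R)^'+ => e.
have e0 : 0 < e by near: e; exact: nbhs_right_gt.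
have : e < x / (`|K| + 1).
  by near: e; apply: nbhs_right_lt; rewrite divr_gt0.
rewrite ltr_pdivlMr // ltNge => /negP; apply.
have xe : x <= K * e by near: e.
apply: le_trans xe _; rewrite mulrC ler_pM2l //.
by apply: le_trans (ler_norm K) _; rewrite lerDl.
Unshelve. all: by end_near. Qed.

Lemma le_first_order_le f g a b :
  (\forall eps \near (0 : R)^'+, f eps <= g eps) -> a <= b ->
  le_first_order g a -> le_first_order f b.
Proof.
move=> fg ab [K gK]; exists K; near=> e.
have e0 : 0 < e by near: e; exact: nbhs_right_gt.
have fge : f e <= g e by near: e.
have gKe : g e <= a * e + K * e ^+ 2 by near: e.
apply: le_trans fge _; apply: le_trans gKe _.
by rewrite lerD2r ler_wpM2r // ltW.
Unshelve. all: by end_near. Qed.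

Lemma le_first_orderD f g a b : le_first_order f a -> le_first_order g b ->
  le_first_order (fun eps => f eps + g eps) (a + b).
Proof.
move=> [K fK] [L gL]; exists (K + L); near=> e.
have fKe : f e <= a * e + K * e ^+ 2 by near: e.
have gLe : g e <= b * e + L * e ^+ 2 by near: e.
by apply: le_trans (lerD fKe gLe) _; rewrite !mulrDl addrACA.
Unshelve. all: by end_near. Qed.

Lemma le_first_order_sum m (f : 'I_m -> R -> R) (a : 'I_m -> R) :
  (forall i, le_first_order (f i) (a i)) ->
  le_first_order (fun eps => \sum_(i < m) f i eps) (\sum_(i < m) a i).
Proof.
elim: m f a => [|m IH] f a fa.
  by exists 0; near=> e; rewrite !big_ord0 !mul0r addr0.
rewrite big_ord_recr /=.
pose widen := widen_ord (leqnSn m).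
have head := IH (f \o widen) (a \o widen) (fun i => fa (widen i)).
apply: le_first_order_le (lexx _) (le_first_orderD head (fa ord_max)).
by near=> e; rewrite big_ord_recr.
Unshelve. all: by end_near. Qed.

Lemma le_first_order_outer_diff n (a : R -> 'cV[R]_n) (u : 'cV[R]_n) (c : R) :
  0 <= c -> le_first_order (fun eps => enorm (a eps - u)) c ->
  le_first_order (fun eps => opnorm (u *m u^T - a eps *m (a eps)^T))
    (2 * enorm u * c).
Proof.
(* The first summand comes from the second-order part of the hypothesis; the second bounds the
   square of the distance, using [e <= 1]. *)
move=> c0 [K aK]; exists (2 * enorm u * `|K| + (c + `|K|) ^+ 2); near=> e.
have e0 : 0 < e by near: e; exact: nbhs_right_gt.
have e1 : e <= 1 by near: e; exact: nbhs_right_le.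
have ae : enorm (a e - u) <= c * e + K * e ^+ 2 by near: e.
rewrite -opnormN opprB; apply: le_trans (opnorm_outer_diff _ _) _.
have ae' : enorm (a e - u) <= c * e + `|K| * e ^+ 2.
  apply: le_trans ae _; rewrite lerD2l ler_wpM2r ?ler_norm //.
  exact: sqr_ge0.
have d2 : enorm (a e - u) ^+ 2 <= ((c + `|K|) * e) ^+ 2.
  have cK0 : 0 <= (c + `|K|) * e by apply: mulr_ge0 (ltW e0); exact: addr_ge0.
  rewrite ler_pXn2r ?nnegrE ?enorm_ge0 //.
  apply: le_trans ae' _; rewrite mulrDl lerD2l ler_wpM2l // expr2.
  by rewrite -[leRHS]mulr1 ler_pM2l.
have u0 : 0 <= 2 * enorm u by rewrite mulr_ge0 ?enorm_ge0.
apply: le_trans (lerD (ler_wpM2l u0 ae') d2) _.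
by rewrite le_eqVlt; apply/orP; left; apply/eqP; ring.
Unshelve. all: by end_near. Qed.

(** A cruder [O(eps)] variant of the preceding bound, sufficient for passing to the limit. *)
Lemma le_enorm_outer_diff n (a u : 'cV[R]_n) (K e : R) :
  0 <= e <= 1 -> enorm (a - u) <= K * e ->
  opnorm (a *m a^T - u *m u^T) <= (2 * enorm u * K + K ^+ 2) * e.
Proof.
move=> /andP[e0 e1] au; apply: le_trans (opnorm_outer_diff _ _) _.
have u0 : 0 <= 2 * enorm u by rewrite mulr_ge0 ?enorm_ge0.
rewrite [leRHS]mulrDl -(mulrA _ K); apply: lerD; first exact: ler_wpM2l.
have : enorm (a - u) ^+ 2 <= (K * e) ^+ 2.
  by rewrite ler_pXn2r ?nnegrE ?enorm_ge0 // (le_trans _ au) // enorm_ge0.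
move/le_trans; apply; rewrite exprMn ler_wpM2l ?sqr_ge0 // expr2.
by rewrite -[leRHS]mulr1 ler_wpM2l.
Qed.

End FirstOrder.

(** * Gram matrices, traces and positivity of [t 0] *)

Section Gram.
Variables (R : realType) (n : nat).

Lemma rows_ofE (a : nat -> 'cV[R]_n) (i j : 'I_n) : rows_of a i j = a i j 0.
Proof.
rewrite summxE (bigD1 i) //= big1 ?addr0 => [|k ki].
  by rewrite mxE big_ord1 !mxE eqxx mul1r.
by rewrite mxE big_ord1 !mxE eq_sym (negbTE (_ : k != i :> nat)) ?mul0r.
Qed.

Lemma gram_rows_of (a : nat -> 'cV[R]_n) :
  (rows_of a)^T *m rows_of a = \sum_(k < n) a k *m (a k)^T.
Proof.
apply/matrixP => i j; rewrite mxE summxE; apply: eq_bigr => k _.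
by rewrite mxE !rows_ofE outerE.
Qed.

Lemma mxtrace_outer (x : 'cV[R]_n) : \tr (x *m x^T) = enorm x ^+ 2.
Proof. by rewrite enorm_sqr; apply: eq_bigr => i _; rewrite outerE expr2. Qed.

Lemma mxtrace_toeplitz (t : nat -> R) : \tr (toeplitz n t) = n%:R * t 0%N.
Proof.
rewrite /mxtrace (eq_bigr (fun=> t 0%N)) => [|i _].
  by rewrite sumr_const card_ord mulr_natl.
by rewrite mxE subrr absz0.
Qed.

(** The quadratic form of T at the first unit vector equals [t 0]. *)
Lemma posdef_toeplitz_gt0 (t : nat -> R) :
  (0 < n)%N -> posdef (toeplitz n t) -> 0 < t 0%N.
Proof.
move=> n0 [_ /(_ (delta_mx (Ordinal n0) 0))].
rewrite trmx_delta -rowE -colE !mxE subrr absz0; apply.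
apply/negP => /eqP/matrixP/(_ (Ordinal n0) 0); rewrite !mxE !eqxx => /eqP.
by rewrite oner_eq0.
Qed.

End Gram.

(** * Zero patterns, steps, factorization and norm inequalities of the exact vectors *)

(* The exact relations are obtained from the computed ones by letting
   [eps] tend to 0, so no separate proof that FACTOR is well defined is
   needed. *)
Section ExactRelations.
Variables (R : realType) (n : nat) (t : nat -> R) (r : nat -> rule).
Variables (c0 cm ch : R) (ut vt : R -> nat -> 'cV[R]_n).
Hypothesis n0 : (0 < n)%N.
Hypothesis t0 : 0 < t 0%N.
Hypothesis run : computed t r c0 cm ch ut vt.
Local Notation Z := (Defs.shift R n).
Local Notation u := (u_ n t r).
Local Notation v := (v_ n t r).

(** The computed entry is exactly 0, so the exact entry is at most [K * e] in absolute value for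
    every small [e]. *)
Lemma exact_zeros k (i : 'I_n) : (k < n)%N ->
  ((i < k)%N -> u k i 0 = 0) /\ ((i <= k)%N -> v k i 0 = 0).
Proof.
move=> kn; have [K close] := computed_approx run.
have small : \forall e \near (0 : R)^'+, ((i < k)%N -> `|u k i 0| <= K * e) /\
    ((i <= k)%N -> `|v k i 0| <= K * e).
  near=> e.
  have [] : enorm (ut e k - u k) <= K * e /\ enorm (vt e k - v k) <= K * e.
    by move: k kn; near: e.
  have [zu zv] : ((i < k)%N -> ut e k i 0 = 0) /\
      ((i <= k)%N -> vt e k i 0 = 0).
    by move: k i kn; near: e; exact: computed_zeros run.
  move=> /(le_trans (le_entry_enorm _ i)) cu /(le_trans (le_entry_enorm _ i)) cv.
  by split=> ik; [move: cu | move: cv]; rewrite !mxE ?zu ?zv // sub0r normrN.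
split=> ik; apply/eqP; rewrite -normr_le0; apply: (@near_le_linear _ _ K);
  by apply: filterS small => e [su sv]; auto.
Unshelve. all: by end_near. Qed.

Lemma opnorm_second_order (G E : 'M[R]_n) (K L e : R) :
  opnorm G <= L ->
  (forall i j, `|E i j| <= K * (e ^+ 2 * opnorm G)) ->
  opnorm E <= n%:R * `|K| * L * e ^+ 2.
Proof.
move=> GL EK; have L0 := le_trans (opnorm_ge0 G) GL.
have -> : n%:R * `|K| * L * e ^+ 2 = n%:R * (`|K| * (e ^+ 2 * L)) by ring.
apply: opnorm_le_entries => [|i j]; first exact: mulr_ge0 (normr_ge0 K) (mulr_ge0 (sqr_ge0 e) L0).
apply: le_trans (EK i j) _.
have G0 : 0 <= e ^+ 2 * opnorm G.
  exact: mulr_ge0 (sqr_ge0 e) (opnorm_ge0 G).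
apply: le_trans (ler_wpM2r G0 (ler_norm K)) _.
by rewrite ler_wpM2l // ler_wpM2l ?sqr_ge0.
Qed.

(** The difference of the two sides does not depend on [eps], yet the computed step bounds its norm
    by a multiple of [eps]; so it is 0. *)
Lemma exact_step k : (k.+1 < n)%N ->
  u k.+1 *m (u k.+1)^T - v k.+1 *m (v k.+1)^T
    = Z *m u k *m (u k)^T *m Z^T - v k *m (v k)^T.
Proof.
move=> kn; have [G [E [K step]]] := computed_step run.
have [M close] := computed_approx run.
pose d (x : 'cV[R]_n) := 2 * enorm x * M + M ^+ 2.
pose L := local_bound n t r cm ch k 0.
apply/eqP; rewrite -subr_eq0; apply/eqP/opnorm_eq0.
(* Each [d] pays for replacing one computed outer product by the exact one, [L] for the term
   [e *: G e k], and the last summand for [E e k], where [e ^+ 2 <= e]. *)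
apply: (@near_le_linear _ _ (d (u k.+1) + d (v k.+1) + d (u k) + d (v k)
  + L + n%:R * `|K| * L)).
near=> e.
have e0 : 0 < e by near: e; exact: nbhs_right_gt.
have e1 : e <= 1 by near: e; exact: nbhs_right_le.
have e01 : 0 <= e <= 1 by rewrite ltW.
have [stepE EK GL] : [/\ ut e k.+1 *m (ut e k.+1)^T
    - vt e k.+1 *m (vt e k.+1)^T = Z *m ut e k *m (ut e k)^T *m Z^T
    - vt e k *m (vt e k)^T + e *: G e k + E e k,
    forall i j, `|E e k i j| <= K * (e ^+ 2 * opnorm (G e k)) &
    forall j : nat, (j < n)%N ->
      opnorm (Z ^+ j *m G e k *m (Z ^+ j)^T) <= local_bound n t r cm ch k j]
  by (move: k kn {d L}; near: e).
have near_e m : (m < n)%N -> enorm (ut e m - u m) <= M * e /\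
  enorm (vt e m - v m) <= M * e by (move: m; near: e).
have [du dv] := near_e _ (ltnW kn); have [du' dv'] := near_e _ kn.
have Gk : opnorm (G e k) <= L.
  by have := GL 0%N n0; rewrite expr0 trmx1 mulmx1 mul1mx.
have L0 := le_trans (opnorm_ge0 _) Gk.
have Ee : opnorm (E e k) <= n%:R * `|K| * L * e.
  apply: le_trans (opnorm_second_order Gk EK) _.
  by rewrite ler_wpM2l ?mulr_ge0 // expr2 -[leRHS]mulr1 ler_pM2l.
have Ge : opnorm (e *: G e k) <= L * e.
  by apply: le_trans (opnormZ_le _ _) _; rewrite gtr0_norm // mulrC ler_pM2r.
have Zu : opnorm (Z *m (ut e k *m (ut e k)^T - u k *m (u k)^T) *m Z^T)
    <= d (u k) * e.
  have := @opnorm_shift_congr R n 1 (ut e k *m (ut e k)^T - u k *m (u k)^T).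
  by rewrite expr1 => /le_trans; apply; exact: le_enorm_outer_diff.
have -> : u k.+1 *m (u k.+1)^T - v k.+1 *m (v k.+1)^T
    - (Z *m u k *m (u k)^T *m Z^T - v k *m (v k)^T)
  = (vt e k.+1 *m (vt e k.+1)^T - v k.+1 *m (v k.+1)^T)
    - (ut e k.+1 *m (ut e k.+1)^T - u k.+1 *m (u k.+1)^T)
    + Z *m (ut e k *m (ut e k)^T - u k *m (u k)^T) *m Z^T
    - (vt e k *m (vt e k)^T - v k *m (v k)^T) + e *: G e k + E e k.
  rewrite mulmxBr mulmxBl !mulmxA; move: stepE.
  move: (e *: _) (E e k) (Z *m ut e k *m _ *m _) (Z *m u k *m _ *m _) => g f X Y.
  move: (ut e k.+1 *m _) (vt e k.+1 *m _) (vt e k *m _) => a b c.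
  move: (u k.+1 *m _) (v k.+1 *m _) (v k *m _) => a' b' c' /matrixP st.
  by apply/matrixP => i j; move: (st i j); rewrite !mxE; lra.
apply: le_trans (opnormD _ _) _; rewrite 5!mulrDl.
apply: lerD => //; apply: le_trans (opnormD _ _) _; apply: lerD => //.
apply: le_trans (opnormB _ _) _.
apply: lerD; last exact: le_enorm_outer_diff.
apply: le_trans (opnormD _ _) _; apply: lerD => //.
apply: le_trans (opnormB _ _) _; rewrite [leRHS]addrC.
by apply: lerD; exact: le_enorm_outer_diff.
Unshelve. all: by end_near. Qed.

Lemma last_u_zeros (i : 'I_n) : (i < n.-1)%N -> u n.-1 i 0 = 0.
Proof. by move=> lt_i; case: (@exact_zeros n.-1 i) => [|->]; rewrite ?prednK. Qed.

Lemma last_v_eq0 : v n.-1 = 0.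
Proof.
apply/matrixP => i j; rewrite ord1 mxE.
have [|_ ->//] := @exact_zeros n.-1 i; first by rewrite prednK.
by rewrite -ltnS prednK.
Qed.

(** Both sides have the same displacement, the exact steps contributing no error terms. *)
Lemma exact_factorization : \sum_(k < n) u k *m (u k)^T = toeplitz n t.
Proof.
rewrite (@rank_one_sum_expansion _ _ u v (fun=> 0)) //; first last.
- exact: last_v_eq0.
- exact: last_u_zeros.
- by move=> k kn; rewrite addr0 exact_step.
rewrite [\sum_(k < n.-1) 0]big1 // addr0 [RHS]displacement_expansion.
by rewrite toeplitz_displacement.
Qed.

Lemma sum_enorm_u : \sum_(k < n) enorm (u k) ^+ 2 = n%:R * t 0%N.
Proof.
rewrite -mxtrace_toeplitz -exact_factorization raddf_sum /=.
by apply: eq_bigr => k _; rewrite mxtrace_outer.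
Qed.

(** Induction on the distance from [k] to [n.-1], where [v] vanishes. The trace of the exact step
    conjugated by [Z ^+ j] equates the gap between the two squared norms here with the gap between
    those of [Z ^+ j *m u k.+1] and [Z ^+ j *m v k.+1]. *)
Lemma enorm_v_le j k : (k < n)%N ->
  enorm (Z ^+ j *m v k) <= enorm (Z ^+ j.+1 *m u k).
Proof.
move=> kn; have : (k <= n.-1)%N by rewrite -ltnS prednK.
move: {-1}(n.-1 - k)%N (erefl (n.-1 - k)%N) => d; elim: d k kn => [|d IH] k kn.
  move=> nk kle; have -> : k = n.-1 by lia.
  by rewrite last_v_eq0 mulmx0 enorm0 enorm_ge0.
move=> nk kle; have kn' : (k.+1 < n)%N by lia.
have {IH} IH : enorm (Z ^+ j *m v k.+1) <= enorm (Z ^+ j *m u k.+1).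
  apply: le_trans (enorm_shift_exprS _ _); apply: IH => //; lia.
have normE x : enorm (Z ^+ j *m x) ^+ 2
    = \tr (Z ^+ j *m (x *m x^T) *m (Z ^+ j)^T).
  by rewrite -mxtrace_outer trmx_mul !mulmxA.
have := congr1 (fun A => \tr (Z ^+ j *m A *m (Z ^+ j)^T)) (exact_step kn').
rewrite 2!mulmxBr 2!mulmxBl 2!raddfB /= -!normE.
have -> : Z *m u k *m (u k)^T *m Z^T = (Z *m u k) *m (Z *m u k)^T.
  by rewrite trmx_mul !mulmxA.
rewrite -normE -shift_exprSr => eqn.
have {}IH : enorm (Z ^+ j *m v k.+1) ^+ 2 <= enorm (Z ^+ j *m u k.+1) ^+ 2.
  by rewrite ler_pXn2r ?nnegrE ?enorm_ge0.
rewrite -(@ler_pXn2r _ 2) ?nnegrE ?enorm_ge0 //.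
lra.
Qed.

Lemma enorm_v_le_u j k : (k < n)%N ->
  enorm (Z ^+ j *m v k) <= enorm (Z ^+ j *m u k).
Proof. by move=> kn; apply: le_trans (enorm_v_le j kn) (enorm_shift_exprS _ _). Qed.

Lemma enorm_v_init_le : enorm (v_init n t) <= enorm (u_init n t).
Proof.
by have := @enorm_v_le_u 0 0 n0; rewrite expr0 !mul1mx.
Qed.

End ExactRelations.

(** * Sums over the [n.-1] steps compared with sums over the [n] rows *)

Section PartialSums.
Variables (R : numDomainType) (n : nat) (f : nat -> R).
Hypothesis f_ge0 : forall k, 0 <= f k.

Lemma sum_init_le : \sum_(k < n.-1) f k <= \sum_(k < n) f k.
Proof.
case: n => [|m]; first by rewrite !big_ord0.
by rewrite big_ord_recr /= lerDl.
Qed.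

Lemma sum_tail_le : \sum_(k < n.-1) f k.+1 <= \sum_(k < n) f k.
Proof.
case: n => [|m]; first by rewrite !big_ord0.
by rewrite big_ord_recl /= lerDr.
Qed.

End PartialSums.

(** * First-order error of the factorization and its summation *)

Section ErrorBound.
Variables (R : realType) (n : nat) (t : nat -> R) (r : nat -> rule).
Variables (c0 cm ch : R) (ut vt : R -> nat -> 'cV[R]_n).
Hypothesis n0 : (0 < n)%N.
Hypothesis t0 : 0 < t 0%N.
Hypotheses (c0_ge0 : 0 <= c0) (cm_ge0 : 0 <= cm) (ch_ge0 : 0 <= ch).
Hypothesis run : computed t r c0 cm ch ut vt.
Local Notation Z := (Defs.shift R n).
Local Notation u := (u_ n t r).
Local Notation v := (v_ n t r).
Local Notation bound := (local_bound n t r cm ch).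

Lemma le_first_order_local_error : exists F : R -> nat -> 'M[R]_n,
  (\forall eps \near (0 : R)^'+, forall k, (k.+1 < n)%N ->
    ut eps k.+1 *m (ut eps k.+1)^T - vt eps k.+1 *m (vt eps k.+1)^T
      = Z *m ut eps k *m (ut eps k)^T *m Z^T - vt eps k *m (vt eps k)^T
        + F eps k) /\
  forall k j, (k.+1 < n)%N -> (j < n)%N ->
    le_first_order (fun eps => opnorm (Z ^+ j *m F eps k *m (Z ^+ j)^T))
      (bound k j).
Proof.
have [G [E [K step]]] := computed_step run.
exists (fun eps k => eps *: G eps k + E eps k); split.
  apply: filterS step => e step k kn.
  by have [-> _ _] := step k kn; rewrite addrA.
(* The norm of [G] itself is controlled by the bound at [j = 0], and this enters the second-order
   constant through [E]. *)
move=> k j kn jn; exists (n%:R * `|K| * bound k 0); near=> e.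
have e0 : 0 < e by near: e; exact: nbhs_right_gt.
have [_ EK GL] : [/\ ut e k.+1 *m (ut e k.+1)^T
    - vt e k.+1 *m (vt e k.+1)^T = Z *m ut e k *m (ut e k)^T *m Z^T
    - vt e k *m (vt e k)^T + e *: G e k + E e k,
    forall i j, `|E e k i j| <= K * (e ^+ 2 * opnorm (G e k)) &
    forall j : nat, (j < n)%N ->
      opnorm (Z ^+ j *m G e k *m (Z ^+ j)^T) <= bound k j]
  by (move: k kn; near: e).
have Gk : opnorm (G e k) <= bound k 0.
  by have := GL 0%N n0; rewrite expr0 trmx1 mulmx1 mul1mx.
rewrite mulmxDr mulmxDl; apply: le_trans (opnormD _ _) _; apply: lerD.
  rewrite -scalemxAr -scalemxAl; apply: le_trans (opnormZ_le _ _) _.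
  by rewrite gtr0_norm // mulrC ler_pM2r // GL.
by apply: le_trans (opnorm_shift_congr _ _) _; exact: opnorm_second_order EK.
Unshelve. all: by end_near. Qed.

(** T and the computed product are expanded by the same displacement formula and subtracted term by
    term in [j]; each term holds the initial errors and all local errors, congruent by [Z ^+ j]. *)
Lemma le_first_order_factorization_error :
  le_first_order
    (fun eps => opnorm (toeplitz n t - (rows_of (ut eps))^T *m rows_of (ut eps)))
    (\sum_(j < n) (4 * c0 * enorm (u_init n t) ^+ 2
                   + \sum_(k < n.-1) bound k j)).
Proof.
have [F [step Fj]] := le_first_order_local_error.
have [init_u init_v] := computed_init run.
pose du e := u 0 *m (u 0)^T - ut e 0%N *m (ut e 0%N)^T.
pose dv e := v 0 *m (v 0)^T - vt e 0%N *m (vt e 0%N)^T.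
apply: (@le_first_order_le _ _ (fun e => \sum_(j < n)
  (opnorm (du e) + opnorm (dv e)
   + \sum_(k < n.-1) opnorm (Z ^+ j *m F e k *m (Z ^+ j)^T))) _ _ _ (lexx _)).
  near=> e.
  have zeros k (i : 'I_n) : (k < n)%N ->
      ((i < k)%N -> ut e k i 0 = 0) /\ ((i <= k)%N -> vt e k i 0 = 0).
    by move: k i; near: e; exact: computed_zeros run.
  have stepe : forall k, (k.+1 < n)%N ->
      ut e k.+1 *m (ut e k.+1)^T - vt e k.+1 *m (vt e k.+1)^T
      = Z *m ut e k *m (ut e k)^T *m Z^T - vt e k *m (vt e k)^T + F e k.
    by near: e.
  rewrite gram_rows_of (rank_one_sum_expansion stepe n0); first last.
  - apply/matrixP => i j; rewrite ord1 mxE.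
    have [|_ ->//] := zeros n.-1 i; first by rewrite prednK.
    by rewrite -ltnS prednK.
  - by move=> i lt_i; have [|->//] := zeros n.-1 i; rewrite prednK.
  rewrite [toeplitz n t]displacement_expansion toeplitz_displacement // -sumrB.
  apply: le_trans (opnorm_sum _ _) _; apply: ler_sum => j _.
  rewrite -mulmxBl -mulmxBr.
  have -> : u_init n t *m (u_init n t)^T - v_init n t *m (v_init n t)^T
    - (ut e 0%N *m (ut e 0%N)^T - vt e 0%N *m (vt e 0%N)^T
       + \sum_(k < n.-1) F e k) = du e - dv e - \sum_(k < n.-1) F e k.
    rewrite opprD addrA; congr (_ - _); rewrite /du /dv !opprB.
    by rewrite addrACA [RHS]addrACA [- _ + _]addrC.
  rewrite mulmxBr mulmxBl; apply: le_trans (opnormB _ _) _; apply: lerD.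
    by apply: le_trans (opnorm_shift_congr _ _) _; exact: opnormB.
  rewrite mulmx_sumr mulmx_suml; exact: opnorm_sum.
(* The constant 4 is 2 from each initial vector; the part of [v_init] is enlarged by its norm being
   at most that of [u_init]. *)
have -> : \sum_(j < n) (4 * c0 * enorm (u_init n t) ^+ 2
      + \sum_(k < n.-1) bound k j)
    = \sum_(j < n) (2 * enorm (u 0) * (c0 * enorm (u 0))
      + 2 * enorm (u 0) * (c0 * enorm (u 0)) + \sum_(k < n.-1) bound k j).
  by apply: eq_bigr => j _; congr (_ + _); rewrite -[u 0]/(u_init n t); ring.
have u0 := enorm_ge0 (u_init n t).
have c0u : 0 <= c0 * enorm (u_init n t) by exact: mulr_ge0.
apply: le_first_order_sum => j; apply: le_first_orderD.
  apply: le_first_orderD; first exact: le_first_order_outer_diff.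
  apply: le_first_order_le (le_first_order_outer_diff c0u init_v).
    exact: nearW.
  rewrite ler_wpM2r // ler_wpM2l //; exact: enorm_v_init_le run.
by apply: le_first_order_sum => k; apply: Fj => //; rewrite -ltn_predRL.
Unshelve. all: by end_near. Qed.

(** The Frobenius norm of the unscaled matrix is the square root of [2 + 2 * s ^+ 2], at most 2. *)
Lemma opnorm_Hmx_le (s c : R) : 0 < c -> s ^+ 2 <= 1 ->
  opnorm (Hmx s c) <= 2 / c.
Proof.
move=> c_gt0 s1; apply: le_trans (opnormZ_le _ _) _.
rewrite gtr0_norm ?invr_gt0 // mulrC ler_pM2r ?invr_gt0 //.
apply: le_trans (opnorm_le_frobenius _) _.
rewrite -(@ler_pXn2r _ 2) ?nnegrE ?sqrtr_ge0 // sqr_sqrtr; last first.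
  by apply: sumr_ge0 => i _; apply: sumr_ge0 => j _; exact: sqr_ge0.
by rewrite !big_ord_recl !big_ord0 !mxE /= expr1n; nra.
Qed.

(* [c = 0] is the case [1 <= s ^+ 2], where [c^-1 = 0] and hence
   [Hmx s c = 0]. *)
Lemma local_bound_hyperbolic k j : (k.+1 < n)%N -> (j <= n)%N ->
  r k = Hyperbolic ->
  bound k j <= 8 * ch * n%:R * enorm (u k) ^+ 2.
Proof.
move=> kn jn rk; rewrite /local_bound rk /=.
set s := sin_ n t r k; set c := cos_ n t r k.
have c_ge0 : 0 <= c by exact: sqrtr_ge0.
have [c_le0|c_gt0] := leP c 0.
  have -> : c = 0 by apply/eqP; rewrite eq_le c_le0 c_ge0.
  rewrite /Hmx invr0 scale0r opnorm0 mulr0 !mul0r.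
  by apply: mulr_ge0 (sqr_ge0 _); rewrite !mulr_ge0.
have c2 : c ^+ 2 = 1 - s ^+ 2.
  rewrite sqr_sqrtr // ltW // ltNge; apply/negP => s1.
  by move: c_gt0; rewrite /c /cos_ /cos_of ler0_sqrtr // ltxx.
have s1 : s ^+ 2 <= 1 by rewrite -subr_ge0 -c2 sqr_ge0.
(* Inverting one row of the hyperbolic rotation replaces the division by [c] with a multiplication
   by [c]. *)
have rot : c *: (Z *m u k) = u k.+1 + s *: v k.+1.
  have -> : u k.+1 = c^-1 *: (Z *m u k - s *: v k) by rewrite /u_ /= rk.
  have -> : v k.+1 = c^-1 *: (v k - s *: (Z *m u k)) by rewrite /v_ /= rk.
  move: (Z *m u k) (v k) => x y; apply/matrixP => i l; rewrite !mxE.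
  have -> : c^-1 * (x i l + - (s * y i l)) + s * (c^-1 * (y i l + - (s * x i l)))
    = c^-1 * (1 - s ^+ 2) * x i l by ring.
  by rewrite -c2 expr2 mulrA mulVf ?mul1r // gt_eqF.
pose f m := enorm (Z ^+ m *m u k.+1).
pose g m := enorm (Z ^+ m.+1 *m u k).
(* Here [|s| <= 1], and [enorm_v_le] bounds the [v] term by [f m.+1]. *)
have f_step m : f m <= c * g m + f m.+1.
  have fE : Z ^+ m *m u k.+1 = c *: (Z ^+ m.+1 *m u k) - s *: (Z ^+ m *m v k.+1).
    by rewrite shift_exprSr scalemxAr rot mulmxDr -scalemxAr addrK.
  rewrite /f fE; apply: le_trans (enormD _ _) _; rewrite -scaleNr !enormZ.
  rewrite ger0_norm // lerD2l normrN.
  apply: le_trans _ (enorm_v_le n0 t0 run m kn); rewrite -[leRHS]mul1r.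
  rewrite ler_wpM2r ?enorm_ge0 //.
  by rewrite -(@ler_pXn2r _ 2) ?nnegrE // expr1n real_normK ?num_real.
(* Iterating [f_step] costs one [c * g i] per step because [g] is nonincreasing; after [n] steps
   nilpotency removes the remainder. *)
have f_le m i : f i <= m%:R * (c * g i) + f (i + m)%N.
  elim: m i => [|m IH] i; first by rewrite mul0r add0r addn0.
  apply: le_trans (f_step i) _; rewrite -natr1 mulrDl mul1r [_ + c * _]addrC.
  rewrite -addrA lerD2l; apply: le_trans (IH i.+1) _; rewrite addSnnS lerD2r.
  by rewrite ler_wpM2l // ler_wpM2l // enorm_shift_exprS.
have f_top : f (j + n)%N = 0.
  by rewrite /f exprD -mulmxA shift_expr_nilpotent mulmx0 enorm0.
have fj : f j <= n%:R * (c * g j) by have := f_le n j; rewrite f_top addr0.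
have gk : g j <= enorm (u k) by exact: enorm_shift_expr.
have vj := enorm_v_le n0 t0 run j (ltnW kn).
have vj' := enorm_v_le_u n0 t0 run j kn.
have H0 := opnorm_ge0 (Hmx s c); have Hc := opnorm_Hmx_le c_gt0 s1.
have g0 : 0 <= g j := enorm_ge0 _.
have f0 : 0 <= f j := enorm_ge0 _.
(* The [2 / c] from [Hmx] cancels the [c] gained in [fj]. The other two factors 2 come from bounding
   each [v] term like its [u] companion. *)
have -> : 8 * ch * n%:R * enorm (u k) ^+ 2
    = ch * (2 / c) * (2 * enorm (u k)) * (2 * (n%:R * (c * enorm (u k)))).
  by field; rewrite gt_eqF.
have e0 : 0 <= enorm (u k) := enorm_ge0 _.
apply: ler_pM; rewrite ?mulr_ge0 ?addr_ge0 ?enorm_ge0 //.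
  apply: ler_pM; rewrite ?mulr_ge0 ?addr_ge0 ?enorm_ge0 //.
    by rewrite ler_wpM2l.
  by rewrite mulr2n mulrDl mul1r; apply: lerD => //; apply: le_trans vj gk.
rewrite mulr2n mulrDl mul1r.
have fu : f j <= n%:R * (c * enorm (u k)).
  by apply: le_trans fj _; rewrite ler_wpM2l // ler_wpM2l.
by apply: lerD => //; apply: le_trans vj' fu.
Qed.

(** Contraction and [enorm_v_le_u] reduce the four terms to two copies of each squared norm on the
    right. *)
Lemma local_bound_mixed k j : (k.+1 < n)%N -> is_mixed (r k) ->
  bound k j <= 2 * cm * (enorm (u k) ^+ 2 + enorm (u k.+1) ^+ 2).
Proof.
move=> kn rk; rewrite /local_bound rk [2 * cm]mulrC -mulrA ler_wpM2l //.
have le2 m : enorm (Z ^+ m *m u k) ^+ 2 <= enorm (u k) ^+ 2.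
  by rewrite ler_pXn2r ?nnegrE ?enorm_ge0 // enorm_shift_expr.
have le2' : enorm (Z ^+ j *m u k.+1) ^+ 2 <= enorm (u k.+1) ^+ 2.
  by rewrite ler_pXn2r ?nnegrE ?enorm_ge0 // enorm_shift_expr.
have vle : enorm (Z ^+ j *m v k) ^+ 2 <= enorm (Z ^+ j *m u k) ^+ 2.
  rewrite ler_pXn2r ?nnegrE ?enorm_ge0 //; exact: enorm_v_le_u run _ _ (ltnW kn).
have vle' : enorm (Z ^+ j *m v k.+1) ^+ 2 <= enorm (Z ^+ j *m u k.+1) ^+ 2.
  rewrite ler_pXn2r ?nnegrE ?enorm_ge0 //; exact: enorm_v_le_u run _ _ kn.
have := le2 j; have := le2 j.+1; lra.
Qed.

(** For each [j], the current and the next rows each contribute at most [n t_0] by the trace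
    identity; the sum over [j] supplies the second factor [n]. *)
Lemma sum_bound_mixed : (forall k, (k.+1 < n)%N -> is_mixed (r k)) ->
  \sum_(j < n) \sum_(k < n.-1) bound k j <= 4 * cm * t 0%N * n%:R ^+ 2.
Proof.
move=> mixed.
have -> : 4 * cm * t 0%N * n%:R ^+ 2
    = \sum_(j < n) 2 * cm * (n%:R * t 0%N + n%:R * t 0%N).
  by rewrite sumr_const card_ord -mulr_natl; ring.
apply: ler_sum => j _; rewrite -{1}(sum_enorm_u n0 t0 run).
rewrite -(sum_enorm_u n0 t0 run).
have u2 k : 0 <= enorm (u k) ^+ 2 by exact: sqr_ge0.
apply: le_trans _ (ler_wpM2l _ (lerD (sum_init_le n u2) (sum_tail_le n u2))).
  rewrite -big_split mulr_sumr; apply: ler_sum => k _ /=.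
  have kn : (k.+1 < n)%N by rewrite -ltn_predRL.
  by apply: local_bound_mixed => //; exact: mixed.
exact: mulr_ge0.
Qed.

Lemma sum_bound_hyperbolic : (forall k, (k.+1 < n)%N -> r k = Hyperbolic) ->
  \sum_(j < n) \sum_(k < n.-1) bound k j <= 8 * ch * t 0%N * n%:R ^+ 3.
Proof.
move=> hyp.
have -> : 8 * ch * t 0%N * n%:R ^+ 3
    = \sum_(j < n) 8 * ch * n%:R * (n%:R * t 0%N).
  by rewrite sumr_const card_ord -mulr_natl; ring.
apply: ler_sum => j _; rewrite -(sum_enorm_u n0 t0 run).
have u2 k : 0 <= enorm (u k) ^+ 2 by exact: sqr_ge0.
apply: le_trans _ (ler_wpM2l _ (sum_init_le n u2)).
  rewrite mulr_sumr; apply: ler_sum => k _.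
  have kn : (k.+1 < n)%N by rewrite -ltn_predRL.
  by apply: local_bound_hyperbolic; rewrite ?hyp // ltnW.
by apply: mulr_ge0 => //; exact: mulr_ge0.
Qed.

(** The squared norm of [u_init] is one term of the sum that the trace identity evaluates to
    [n t_0]. *)
Lemma initial_error_le :
  \sum_(j < n) 4 * c0 * enorm (u_init n t) ^+ 2
    <= 4 * c0 * t 0%N * n%:R ^+ 2.
Proof.
have -> : 4 * c0 * t 0%N * n%:R ^+ 2 = \sum_(j < n) 4 * c0 * (n%:R * t 0%N).
  by rewrite sumr_const card_ord -mulr_natl; ring.
apply: ler_sum => j _; rewrite -(sum_enorm_u n0 t0 run) ler_wpM2l ?mulr_ge0 //.
rewrite (bigD1 (Ordinal n0)) //= lerDl.
by apply: sumr_ge0 => k _; exact: sqr_ge0.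
Qed.

End ErrorBound.

Theorem corollary5p1 (R : realType) (c0 cm ch : R)
    (hc0 : 0 <= c0) (hcm : 0 < cm) (hch : 0 < ch) :
  exists C : R,
    forall (n : nat) (t : nat -> R) (r : nat -> rule)
           (ut vt : R -> nat -> 'cV[R]_n),
      (0 < n)%N ->
      posdef (toeplitz n t) ->
      computed t r c0 cm ch ut vt ->
      exists DT : R -> 'M[R]_n,
        [/\ \forall eps \near (0 : R)^'+,
              is_trig_mx (rows_of (ut eps))^T /\
              toeplitz n t =
                (rows_of (ut eps))^T *m rows_of (ut eps) + DT eps,
            (forall k : nat, (k.+1 < n)%N -> is_mixed (r k)) ->
              le_first_order (fun eps => opnorm (DT eps))
                (C * t 0%N * n%:R ^+ 2) &
            (forall k : nat, (k.+1 < n)%N -> r k = Hyperbolic) ->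
              le_first_order (fun eps => opnorm (DT eps))
                (C * t 0%N * n%:R ^+ 3)].
Proof.
have cm_ge0 := ltW hcm; have ch_ge0 := ltW hch.
(* The summands come from the initial rounding, the mixed steps and the hyperbolic steps
   respectively. *)
exists (4 * c0 + 4 * cm + 8 * ch) => n t r ut vt n0 pd run.
have t0 := posdef_toeplitz_gt0 n0 pd.
have err := le_first_order_factorization_error n0 t0 hc0 run.
have init := initial_error_le n0 t0 hc0 run.
have n1 : 1 <= n%:R :> R by rewrite ler1n.
have weaken (m : nat) (a b : R) : 0 <= a -> a <= b ->
    a * t 0%N * n%:R ^+ m <= b * t 0%N * n%:R ^+ m.
  by move=> a0 ab; rewrite ler_wpM2r ?exprn_ge0 // ler_pM2r.
exists (fun eps => toeplitz n t - (rows_of (ut eps))^T *m rows_of (ut eps)).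
split.
- near=> e; split; last by rewrite addrC subrK.
  have zeros k (i : 'I_n) : (k < n)%N ->
      ((i < k)%N -> ut e k i 0 = 0) /\ ((i <= k)%N -> vt e k i 0 = 0).
    by move: k i; near: e; exact: computed_zeros run.
  (* [is_trig_mx] means lower triangular, hence the transpose; its entries above the diagonal are
     the leading zeros of [ut e j]. *)
  apply/is_trig_mxP => i j ij; rewrite mxE rows_ofE.
  by have [->] := zeros j i (ltn_ord j).
- move=> mixed; apply: le_first_order_le err; first exact: nearW.
  rewrite big_split /=.
  apply: le_trans (lerD init (sum_bound_mixed n0 t0 cm_ge0 run mixed)) _.
  by rewrite -!mulrDl weaken ?addr_ge0 ?mulr_ge0 // lerDl mulr_ge0.
- move=> hyp; apply: le_first_order_le err; first exact: nearW.
  rewrite big_split /=.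
  apply: le_trans (lerD init (sum_bound_hyperbolic n0 t0 ch_ge0 run hyp)) _.
  (* The initial error is only quadratic in [n] and is raised to [n ^+ 3], which needs [1 <= n]. *)
  apply: (@le_trans _ _ ((4 * c0 + 8 * ch) * t 0%N * n%:R ^+ 3)).
    have -> : (4 * c0 + 8 * ch) * t 0%N * n%:R ^+ 3
        = 4 * c0 * t 0%N * n%:R ^+ 3 + 8 * ch * t 0%N * n%:R ^+ 3 by ring.
    rewrite lerD2r; apply: ler_wpM2l; last exact: ler_weXn2l.
    by rewrite !mulr_ge0 // ltW.
  by rewrite weaken ?addr_ge0 ?mulr_ge0 // lerD2r lerDl mulr_ge0.
Unshelve. all: by end_near. Qed.
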